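(* Let $p$ be a prime, let $k\geq 1$ be an integer, let $f\in F_p[x]$ be an irreducible polynomial of degree $k$, and let $K_f=F_p[x]/(f)$. Then the graph $C_f$ is connected if and only if $x$ is primitive.
   Context: $F_p$ is the field with $p$ elements, and the class of the polynomial $x$ in $K_f=F_p[x]/(f)$ is again denoted $x$. Let $S=\{x,x^p,x^{p^2},\dots,x^{p^{k-1}}\}\subset K_f$ be the set of conjugates of $x$, and $K_f^\times=K_f\setminus\{0\}$. The element $x$ is primitive if it generates the group of units $K_f^\times$. The (undirected) graph $C_f$ has vertex set $K_f\times K_f^\times$. For vertices $(y,z),(y',z')$ and $s\in S$ there is an edge between $(y,z)$ and $(y',z')$ if either $y'-y=s$ and $z=z'$, or $y,y'\neq 0$ and $y'y^{-1}=z'z^{-1}=s$. *)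

(* Defs.v *)
From HB Require Import structures.
From mathcomp Require Import all_boot all_order all_fingroup all_algebra.
From mathcomp Require Import all_solvable all_field.

Set Implicit Arguments.
Unset Strict Implicit.
Unset Printing Implicit Defensive.

Import GRing.Theory.
Local Open Scope ring_scope.

(* [{poly %/ h}] is R[X]/(h) only for monic h: for other h the library silently
   takes the quotient by 'X.  Since f is an arbitrary irreducible polynomial,
   the quotient is taken by its monic associate, which generates the same
   ideal (see [qclass_eq0]). *)
Definition monic_associate (F : fieldType) (f : {poly F}) : {poly F} :=
  (lead_coef f)^-1 *: f.

Lemma monic_associate_irreducible (F : fieldType) (f : {poly F}) :
  irreducible_poly f -> monic_irreducible_poly (monic_associate f).
Proof.
move=> f_irr; have lf0 : lead_coef f != 0.
  by rewrite lead_coef_eq0; apply: irredp_neq0.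
split; last by rewrite monicE lead_coefZ mulVf.
have h_eqp : monic_associate f %= f by apply: eqp_scale; rewrite invr_eq0.
split; first by rewrite (eqp_size h_eqp); case: f_irr.
move=> q q1; rewrite (eqp_dvdr _ h_eqp) => q_dvd.
by rewrite (eqp_rtrans h_eqp); case: f_irr => _; apply.
Qed.

Section QuotientField.

Variables (F : finFieldType) (f : {poly F}) (f_irr : irreducible_poly f).

Definition quotient_field : finFieldType :=
  {poly %/ monic_associate f with monic_associate_irreducible f_irr}.

Definition qclass (q : {poly F}) : quotient_field :=
  in_qpoly (monic_associate f) q.

Lemma qclass_eq0 (q : {poly F}) : (qclass q == 0) = (f %| q).
Proof.
have h_mi := monic_associate_irreducible f_irr.
have lf0 : (lead_coef f)^-1 != 0.
  by rewrite invr_eq0 lead_coef_eq0; apply: irredp_neq0.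
rewrite -(dvdpZl _ _ lf0) -/(monic_associate f) -val_eqE /=.
by rewrite (mk_monicE h_mi) -Pdiv.IdomainMonic.modpE ?h_mi.
Qed.

Definition xclass : quotient_field := qclass 'X.

End QuotientField.

Definition Frobenius_conjugates (p k : nat) (K : finFieldType) (x : K) : {set K} :=
  [set x ^+ (p ^ i) | i : 'I_k].

(* Requiring x to be a unit matters: for x = 0 in F_2 the group of units is
   trivial but x is not one of its elements. *)
Definition generates_units (K : finFieldType) (x : K) : Prop :=
  exists u : {unit K}, val u = x /\ generator [set: {unit K}] u.

Section Graph.

Variables (K : finFieldType) (S : {set K}).

(* As K is a field, {unit K} consists of the nonzero elements of K. *)
Definition vertex : finType := (K * {unit K})%type.

Definition step (s : K) (v w : vertex) : bool :=
  (w.1 - v.1 == s) && (v.2 == w.2)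
  || [&& v.1 != 0, w.1 != 0, w.1 * v.1^-1 == s & val w.2 * (val v.2)^-1 == s].

(* Edges are undirected, hence the symmetrization. *)
Definition adjacent : rel vertex :=
  fun v w => [exists s in S, step s v w || step s w v].

End Graph.

Definition Cgraph (p k : nat) (f : {poly 'F_p}) (f_irr : irreducible_poly f) :
    rel (vertex (quotient_field f_irr)) :=
  adjacent (Frobenius_conjugates p k (xclass f_irr)).
Arguments Cgraph {p} k {f} f_irr.

Definition graph_connected (V : finType) (e : rel V) : Prop :=
  forall v w : V, connect e v w.

(* Main.v *)
(* If x = 0 then no move changes the first coordinate.  Otherwise every move
   preserves the coset of the second coordinate modulo the group generated by x,
   so connectedness forces x to be primitive.
   Conversely let x be primitive.  As long as the first coordinate is nonzero
   both coordinates can be multiplied by the same power of x.  Conjugating the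
   translation by x with such a multiplication translates the first coordinate
   by any power of x, hence by any nonzero element, between nonzero values.
   So all (y, z) with the same z are connected, and (1, z) is adjacent
   to (x, x z).  In particular only the conjugate x itself is needed. *)

Require Import Defs.
From mathcomp Require Import all_boot all_order all_fingroup all_algebra.
From mathcomp Require Import all_solvable all_field.

Set Implicit Arguments.
Unset Strict Implicit.
Unset Printing Implicit Defensive.

Import GRing.Theory.
Local Open Scope ring_scope.

Section Connectedness.

Variables (K : finFieldType) (S : {set K}) (x : K).

Lemma adjacent_sym : symmetric (adjacent S).
Proof. by move=> v w; apply: eq_existsb => s; rewrite orbC. Qed.

Lemma connect_adjacent_sym : connect_sym (adjacent S).
Proof. exact/sym_connect_sym/adjacent_sym. Qed.

Lemma step_adjacent (s : K) (v w : vertex K) :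
  s \in S -> step s v w -> adjacent S v w.
Proof. by move=> sS vw; apply/existsP; exists s; rewrite sS vw. Qed.

(** The conclusion for [v] and [w] is symmetric, so the directed moves suffice for the symmetrized
    relation. *)
Lemma closed_adjacent (a : pred (vertex K)) :
  (forall s v w, s \in S -> step s v w -> (v \in a) = (w \in a)) ->
  closed (adjacent S) a.
Proof.
move=> a_step v w /existsP[s /andP[sS /orP[vw|wv]]].
  exact: a_step sS vw.
by symmetry; apply: a_step sS wv.
Qed.

(** The exponent [n.+1] is positive, so [x = 0] would make every shift in [S] zero, while a quotient
    of nonzero elements is never zero. *)
Lemma connected_neq0 :
  (forall s, s \in S -> exists n, s = x ^+ n.+1) ->
  graph_connected (adjacent S) -> x != 0.
Proof.
move=> S_pow conn; apply/eqP => x0.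
pose a := [pred v : vertex K | v.1 == 0].
have a_closed : closed (adjacent S) a.
  apply: closed_adjacent => s v w /S_pow[n ->]; rewrite x0 expr0n /step /=.
  case/orP=> [/andP[]|/and4P[v0 w0]]; first by rewrite subr_eq0 !inE => /eqP->.
  by rewrite mulf_eq0 invr_eq0 (negPf v0) (negPf w0).
have := closed_connect a_closed (conn (0, 1%g) (1, 1%g)).
by rewrite !inE /= eqxx oner_eq0.
Qed.

Lemma connected_generates :
  (forall s, s \in S -> exists n, s = x ^+ n.+1) ->
  graph_connected (adjacent S) -> generates_units x.
Proof.
move=> S_pow conn; have x_neq0 := connected_neq0 S_pow conn.
have x_unit : x \is a GRing.unit by rewrite unitfE.
pose u : {unit K} := FinRing.Unit x_unit.
exists u; split=> //; apply/eqP/esym/eqP; rewrite eqEsubset subsetT /=.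
apply/subsetP => z _.
pose a := [pred v : vertex K | v.2 \in <[u]>%g].
have a_closed : closed (adjacent S) a.
  apply: closed_adjacent => s v w /S_pow[n ->] /orP[/andP[_ /eqP]|].
    by rewrite !inE => ->.
  case/and4P=> _ _ _ /eqP w_v; rewrite !inE.
  suff -> : w.2 = (u ^+ n.+1 * v.2)%g by rewrite groupMl ?mem_cycle.
  apply: val_inj; rewrite FinRing.val_unitM FinRing.val_unitX /= -w_v.
  by rewrite divrK // (valP v.2).
have := closed_connect a_closed (conn (0, 1%g) (0, z)).
by rewrite !inE /= group1.
Qed.

Section Primitive.

Variable u : {unit K}.
Hypotheses (uS : val u \in S) (u_gen : generator [set: {unit K}] u).

Local Notation conn := (connect (adjacent S)).

Lemma unit_powers (w : {unit K}) : exists n, w = (u ^+ n)%g.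
Proof. by apply/cycleP; rewrite -(eqP u_gen) inE. Qed.

Lemma connect_translate (y : K) (z : {unit K}) : conn (y, z) (y + val u, z).
Proof.
apply/connect1/(step_adjacent uS); rewrite /step /=.
by rewrite addrC addKr !eqxx.
Qed.

Lemma connect_scale (y : K) (z w : {unit K}) :
  y != 0 -> conn (y, z) (val w * y, (w * z)%g).
Proof.
move=> y0; have [n ->] := unit_powers w.
have unit_neq0 (v : {unit K}) : val v != 0 by rewrite -unitfE (valP v).
elim: n => [|n IHn]; first by rewrite expg0 mul1r mul1g.
apply: connect_trans IHn (connect1 _).
apply: (step_adjacent uS); rewrite /step /= expgS; apply/orP; right.
rewrite !FinRing.val_unitM -!mulrA !mulf_neq0 ?unit_neq0 //=.
rewrite [X in val u * X]mulrA divff ?mulf_neq0 ?unit_neq0 // mulr1 eqxx /=.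
by rewrite [X in val u * X]mulrA divff ?mulf_neq0 ?unit_neq0 // mulr1.
Qed.

Lemma connect_fst_neq0 (y y' : K) (z : {unit K}) :
  y != 0 -> y' != 0 -> conn (y, z) (y', z).
Proof.
move=> y0 y'0; have [->|neq] := eqVneq y' y; first exact: connect0.
have d_unit : y' - y \is a GRing.unit by rewrite unitfE subr_eq0.
(* Chosen so that [w * (y' - y) = u]: after scaling both vertices by [w], their first coordinates
   differ by one translation. *)
pose w : {unit K} := (u * (FinRing.Unit d_unit)^-1)%g.
apply: (connect_trans (connect_scale z w y0)).
rewrite connect_adjacent_sym; apply: (connect_trans (connect_scale z w y'0)).
rewrite connect_adjacent_sym.
suff -> : val w * y' = val w * y + val u by apply: connect_translate.
apply/eqP; rewrite addrC -subr_eq -mulrBr /w FinRing.val_unitM.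
by rewrite FinRing.val_unitV /= divrK.
Qed.

Lemma primitive_connected : graph_connected (adjacent S).
Proof.
have u0 : val u != 0 by rewrite -unitfE (valP u).
have to1 y z : conn (y, z) (1, z).
  have [->|y0] := eqVneq y 0; last exact: connect_fst_neq0 y0 (oner_neq0 K).
  apply: connect_trans (connect_translate 0 z) _.
  by rewrite add0r; apply: connect_fst_neq0 u0 (oner_neq0 K).
move=> [y z] [y' z']; apply: connect_trans (to1 y z) _.
rewrite connect_adjacent_sym; apply: connect_trans (to1 y' z') _.
(* This scaling turns [z'] into [z]; [to1] then resets the first coordinate to 1. *)
have := connect_scale z' (z * z'^-1)%g (oner_neq0 K).
by rewrite mulgKV => /connect_trans-> //; apply: to1.
Qed.

End Primitive.

End Connectedness.

Theorem proposition10 (p k : nat) (f : {poly 'F_p}) (p_prime : prime p)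
    (k_ge1 : (1 <= k)%N) (f_irr : irreducible_poly f)
    (f_deg : size f = k.+1) :
  graph_connected (Cgraph k f_irr) <-> generates_units (xclass f_irr).
Proof.
split=> [|[u [u_x u_gen]]].
  apply: connected_generates => s /imsetP[i _ ->].
  by exists (p ^ i).-1; rewrite prednK ?expn_gt0 ?prime_gt0.
apply: (primitive_connected _ u_gen).
(* The conjugate of index 0 is [x] itself; this index exists because [k] is positive. *)
by apply/imsetP; exists (Ordinal k_ge1); rewrite // expn0 expr1.
Qed.
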